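(* Let $\Phi,\Psi$ be nice Young functions with $x\prec\Phi\prec\Psi$. Let $f:\mathbb{Z}_N^d\to\mathbb{C}$ be a nonzero function supported in $E\subset\mathbb{Z}_N^d$ whose Fourier transform $\hat f$ is supported in $S\subset\mathbb{Z}_N^d$. Suppose that $S$ satisfies a $(\Phi,\Psi)$-restriction estimation with constant $C(\Phi,\Psi)$. Then $$|E|\ \geq\ \Phi^{-1}\left(\frac{|S|}{N^d}\right)\left(\frac{N^d}{|S|}\right)^2\frac{1}{\Psi^{-1}(1)\,C(\Phi,\Psi)}.$$
   Context: $N,d$ are positive integers, and for $f:\mathbb{Z}_N^d\to\mathbb{C}$ the Fourier transform is $\hat f(m)=N^{-d}\sum_{x\in\mathbb{Z}_N^d}\chi(-x\cdot m)f(x)$, with $\chi(t)=e^{2\pi i t/N}$ and $m\in\mathbb{Z}_N^d$. A function is supported in $A$ if it vanishes outside $A$. A Young function is a convex $\Phi:[0,\infty)\to[0,\infty]$ with $\Phi(0)=\lim_{x\to0}\Phi(x)=0$ and $\lim_{x\to\infty}\Phi(x)=\infty$. A nice Young function is a continuous Young function with $\lim_{x\to0}\Phi(x)/x=0$ and $\lim_{x\to\infty}\Phi(x)/x=\infty$. $\Phi^{-1}(y)=\sup\{x\ge0:\Phi(x)\le y\}$. For functions $\Phi_1,\Phi_2$ (including power functions), $\Phi_1\prec\Phi_2$ means there are $x_0>0$, $K>0$ with $\Phi_1(x)\le K\Phi_2(x)$ for all $x\ge x_0$. For $A\subset\mathbb{Z}_N^d$: $\|f\|_{L^\Phi(A)}=\inf\{k>0:\sum_{x\in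 A}\Phi(|f(x)|/k)\le1\}$ and $\|f\|_{L^\Phi(\mu_A)}=\inf\{k>0:\frac1{|A|}\sum_{x\in A}\Phi(|f(x)|/k)\le1\}$. $S$ satisfies a $(\Phi,\Psi)$-restriction estimation with (uniform, independent of $N$ and $S$) constant $C(\Phi,\Psi)$ if $\|\hat g\|_{L^\Psi(\mu_S)}\le C(\Phi,\Psi)N^{-d}\|g\|_{L^\Phi(\mathbb{Z}_N^d)}$ for every $g:\mathbb{Z}_N^d\to\mathbb{C}$. *)

(* Defs.v *)
From mathcomp Require Import all_boot all_order all_algebra.
From mathcomp Require Import all_classical all_reals all_analysis.
From mathcomp Require Export complex.
Import Order.TTheory GRing.Theory Num.Theory.
Import numFieldNormedType.Exports.

Set Implicit Arguments.
Unset Strict Implicit.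
Unset Printing Implicit Defensive.

Local Open Scope classical_set_scope.
Local Open Scope ring_scope.
Local Open Scope complex_scope.

(* Elements of Z_N^d are written with their coordinates
   reduced to {0, ..., N-1}; this is valid for every N > 0, including N = 1,
   where the ring 'Z_N would not have N elements. *)
Definition ZNd (N d : nat) : finType := {ffun 'I_d -> 'I_N}.

(* An integer representative of x . m; chi is N-periodic, so only its class
   modulo N matters. *)
Definition dotZ (N d : nat) (x m : ZNd N d) : int :=
  (\sum_(i < d) (x i * m i)%N)%N%:Z.

Definition chi (R : realType) (N : nat) (t : int) : R[i] :=
  cos (2 * pi * t%:~R / N%:R) +i* sin (2 * pi * t%:~R / N%:R).

Definition fourier (R : realType) (N d : nat) (f : ZNd N d -> R[i])
    (m : ZNd N d) : R[i] :=
  ((N ^ d)%N%:R)^-1 * \sum_(x : ZNd N d) chi R N (- dotZ x m) * f x.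

Definition supported_in (R : realType) (N d : nat) (f : ZNd N d -> R[i])
    (A : {set ZNd N d}) : Prop :=
  forall x, x \notin A -> f x = 0.

(* A function [0, oo) -> [0, oo] is represented by Phi : R -> \bar R of which
   only the restriction to [0, oo) is ever used. *)
Definition young (R : realType) (Phi : R -> \bar R) : Prop :=
  [/\ forall x : R, 0 <= x -> (0 <= Phi x)%E,
      forall t x y : R, 0 <= t <= 1 -> 0 <= x -> 0 <= y ->
        (Phi (t * x + (1 - t) * y)%R
           <= t%:E * Phi x + (1 - t)%R%:E * Phi y)%E,
      Phi 0 = 0%E,
      Phi x @[x --> 0^'+] --> 0%E
    & Phi x @[x --> +oo] --> +oo%E].

Definition nice_young (R : realType) (Phi : R -> \bar R) : Prop :=
  [/\ young Phi,
      {within `[0, +oo[, continuous Phi},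
      (Phi x / x%:E)%E @[x --> 0^'+] --> 0%E
    & (Phi x / x%:E)%E @[x --> +oo] --> +oo%E].

(* For a Young function and 0 <= y the set is nonempty (it contains 0) and
   bounded (Phi tends to +oo), so the real supremum is the true one. *)
Definition young_inv (R : realType) (Phi : R -> \bar R) (y : R) : R :=
  sup [set x : R | 0 <= x /\ (Phi x <= y%:E)%E].

Definition prec (R : realType) (Phi1 Phi2 : R -> \bar R) : Prop :=
  exists x0 K : R, [/\ 0 < x0, 0 < K
    & forall x : R, x0 <= x -> (Phi1 x <= K%:E * Phi2 x)%E].

(* The modulus on R[i] as an element of R. In both norms below the set is
   nonempty for a Young function, since Phi tends to 0 at 0 and A is finite,
   so the real infimum is the true one. *)
Notation cabs := ComplexField.Normc.normc.

Definition norm_LPhi (R : realType) (N d : nat) (Phi : R -> \bar R)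
    (A : {set ZNd N d}) (f : ZNd N d -> R[i]) : R :=
  inf [set k : R | 0 < k /\
    (\sum_(x in A) Phi (cabs (f x) / k)%R <= 1)%E].

Definition norm_LPhi_mu (R : realType) (N d : nat) (Phi : R -> \bar R)
    (A : {set ZNd N d}) (f : ZNd N d -> R[i]) : R :=
  inf [set k : R | 0 < k /\
    ((#|A|%:R^-1)%R%:E * \sum_(x in A) Phi (cabs (f x) / k)%R <= 1)%E].

Definition restriction_estimate (R : realType) (N d : nat)
    (Phi Psi : R -> \bar R) (S : {set ZNd N d}) (C : R) : Prop :=
  forall g : ZNd N d -> R[i],
    norm_LPhi_mu Psi S (fourier g)
      <= C * ((N ^ d)%N%:R)^-1 * norm_LPhi Phi [set: ZNd N d]%SET g.

(* Main.v *)
(* Let [F = |f(x0)|] be the maximum of [|f|], [M = N^d], [s = |S|], [e = |E|].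
    Fourier inversion bounds [F] by [s] times the mean of [|fourier f|] over [S],
    and Jensen's inequality bounds that mean by [Psi^-1(1)] times the
    [L^Psi(mu_S)] norm.  The restriction estimate and [|f| <= F 1_E] then give
    [Phi^-1(1/e) <= (s/M) Psi^-1(1) C].  The bound on [e] follows because
    [M <= e s] (uncertainty principle) and [Phi^-1(y)/y] is nonincreasing, so that
    [e Phi^-1(1/e) >= (M/s) Phi^-1(s/M)]. *)

Require Import Defs.
From mathcomp Require Import all_boot all_order all_algebra.
From mathcomp Require Import all_classical all_reals all_analysis.
From mathcomp Require Import zify ring lra.

Set Implicit Arguments.
Unset Strict Implicit.
Unset Printing Implicit Defensive.

Import Order.TTheory GRing.Theory Num.Theory.
Import ComplexField.
Local Open Scope ring_scope.

(** * Additive characters of Z_N^d and their orthogonality *)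

Lemma chi0 (R : realType) (N : nat) : chi R N 0 = 1.
Proof. by rewrite /chi mulr0 mul0r cos0 sin0. Qed.

Lemma chiD (R : realType) (N : nat) (a b : int) :
  chi R N (a + b) = chi R N a * chi R N b.
Proof.
rewrite /chi rmorphD /= mulrDr mulrDl cosD sinD.
by apply/eqP; rewrite eq_complex /= eqxx /= addrC.
Qed.

Lemma chi_sum (R : realType) (N : nat) (I : finType) (F : I -> int) :
  chi R N (\sum_i F i) = \prod_i chi R N (F i).
Proof. exact: (big_morph _ (chiD R N) (chi0 R N)). Qed.

Lemma chi_muln (R : realType) (N : nat) (a : int) (k : nat) :
  chi R N (a * k%:Z) = chi R N a ^+ k.
Proof.
elim: k => [|k IH]; first by rewrite mulr0 chi0.
by rewrite exprS -IH -chiD -addn1 PoszD mulrDr mulr1 addrC.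
Qed.

Lemma normc_chi (R : realType) (N : nat) (t : int) : cabs (chi R N t) = 1.
Proof. by rewrite /chi /Normc.normc cos2Dsin2 sqrtr1. Qed.

Lemma chi_period (R : realType) (N : nat) (a : int) :
  (0 < N)%N -> chi R N a ^+ N = 1.
Proof.
move=> N0; have NR : N%:R != 0 :> R by rewrite pnatr_eq0 -lt0n.
suff chiN : chi R N N = 1.
  rewrite -chi_muln mulrC; case: a => n.
    by rewrite chi_muln chiN expr1n.
  (* For negative [a], factor [chi 0 = 1] over two opposite multiples of [N]; the nonnegative one
     already gives 1. *)
  have := chi0 R N; rewrite -(subrr (N%:Z * n.+1%:Z)) chiD chi_muln chiN expr1n.
  by rewrite mul1r NegzE mulrN.
by rewrite /chi mulfK // mulr_natl cos2pi sin2pi.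
Qed.

(* [cos t = 1 - 2 sin^2 (t / 2)], and [t / 2 = pi |a| / N] lies in [(0, pi)]. *)
Lemma chi_neq1 (R : realType) (N : nat) (a : int) :
  a != 0 -> (`|a| < N)%N -> chi R N a != 1.
Proof.
move=> a0 aN; have N0 : (0 < N)%N by apply: leq_ltn_trans aN.
have NR : 0 < N%:R :> R by rewrite ltr0n.
set b : R := pi * `|a|%N%:R / N%:R.
have b0 : 0 < sin b.
  apply: sin_gt0_pi; rewrite divr_gt0 ?mulr_gt0 ?pi_gt0 ?ltr0n ?absz_gt0 //=.
  by rewrite ltr_pdivrMr // ltr_pM2l ?pi_gt0 // ltr_nat.
have cosE : cos (2 * pi * a%:~R / N%:R) = cos (b *+ 2) :> R.
  rewrite /b -[(_ / _) *+ 2]mulr_natl natr_absz !mulrA; case: (leP 0 a) => ha.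
    by rewrite ger0_norm.
  by rewrite ltr0_norm // rmorphN mulrN mulNr cosN.
apply/eqP => -[]; rewrite cosE cos_mulr2n => h _.
have := sin2cos2 b; nra.
Qed.

Lemma dotZB (N d : nat) (x y m : ZNd N d) :
  dotZ x m - dotZ y m = \sum_i ((x i)%:Z - (y i)%:Z) * (m i)%:Z.
Proof.
rewrite /dotZ !(big_morph Posz PoszD (erefl _)) -sumrB.
by apply: eq_bigr => i _; rewrite !PoszM mulrBl.
Qed.

(** When [x != y], the sum factors over coordinates into geometric sums, and a coordinate where [x]
    and [y] differ contributes 0: the ratio there is an [N]-th root of unity other than 1. *)
Lemma chi_orthogonality (R : realType) (N d : nat) (x y : ZNd N d) :
  (0 < N)%N ->
  \sum_(m : ZNd N d) chi R N (dotZ x m - dotZ y m)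
  = if x == y then (N ^ d)%N%:R else 0.
Proof.
move=> N0; case: eqP => [->|/eqP xy].
  rewrite (eq_bigr (fun=> 1)); last by move=> m _; rewrite subrr chi0.
  by rewrite sumr_const card_ffun !card_ord.
rewrite (eq_bigr (fun m : ZNd N d =>
    \prod_i chi R N ((x i)%:Z - (y i)%:Z) ^+ m i)); last first.
  by move=> m _; rewrite dotZB chi_sum; apply: eq_bigr => i _; rewrite chi_muln.
rewrite -(bigA_distr_bigA (fun i (k : 'I_N) =>
  chi R N ((x i)%:Z - (y i)%:Z) ^+ k)).
have [i xyi] : exists i, x i != y i.
  apply/existsP; apply: contraNT xy; rewrite negb_exists => /forallP h.
  by apply/eqP/ffunP => i; apply/eqP; rewrite -[_ == _]negbK.
rewrite (bigD1 i) //= [X in X * _](_ : _ = 0) ?mul0r //.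
set a := _ - _.
have a1 : chi R N a != 1.
  apply: chi_neq1; first by rewrite subr_eq0.
  by rewrite /a; case: (x i) (y i) => [k hk] [l hl] /=; lia.
(* Multiplying the geometric sum by [chi a - 1] telescopes it to [chi a ^+ N - 1 = 0]. *)
apply: (mulfI (_ : chi R N a - 1 != 0)); first by rewrite subr_eq0.
by rewrite -subrX1 chi_period // subrr mulr0.
Qed.

(** * Fourier inversion, sup bounds and the uncertainty principle *)

Lemma fourier_inversion (R : realType) (N d : nat) (f : ZNd N d -> R[i])
    (x : ZNd N d) :
  (0 < N)%N -> f x = \sum_(m : ZNd N d) chi R N (dotZ x m) * fourier f m.
Proof.
move=> N0; have NR : (N ^ d)%N%:R != 0 :> R[i].
  by rewrite pnatr_eq0 -lt0n expn_gt0 N0.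
(* Exchanging the sums over [m] and [y] isolates the orthogonality kernel, which keeps only
   [y = x]. *)
transitivity (((N ^ d)%N%:R)^-1 *
    \sum_(y : ZNd N d) (\sum_(m : ZNd N d) chi R N (dotZ x m - dotZ y m)) * f y).
  under eq_bigr do rewrite chi_orthogonality //.
  rewrite (bigD1 x) //= big1 => [|y yx].
    by rewrite eqxx addr0 mulKf.
  by rewrite eq_sym (negbTE yx) mul0r.
rewrite mulr_sumr (eq_bigr (fun y => \sum_(m : ZNd N d)
    chi R N (dotZ x m) * (((N ^ d)%N%:R)^-1 * (chi R N (- dotZ y m) * f y)))).
  rewrite exchange_big; apply: eq_bigr => m _.
  by rewrite /fourier !mulr_sumr.
move=> y _; rewrite mulr_suml mulr_sumr; apply: eq_bigr => m _.
by rewrite chiD -mulrA mulrCA.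
Qed.

Lemma normc_sum (R : realType) (I : finType) (P : pred I) (F : I -> R[i]) :
  cabs (\sum_(i | P i) F i) <= \sum_(i | P i) cabs (F i).
Proof.
elim/big_rec2: _ => [|i a b _ h]; first by rewrite Normc.normc0.
by apply: le_trans (le_normcD _ _) _; rewrite lerD2l.
Qed.

Lemma normc_ge0 (R : realType) (z : R[i]) : 0 <= cabs z.
Proof. by case: z => a b; rewrite sqrtr_ge0. Qed.

Lemma normc_natr (R : realType) (n : nat) : cabs (n%:R : R[i]) = n%:R.
Proof. by rewrite normcMn Normc.normc1. Qed.

Lemma normc_le_sum_fourier (R : realType) (N d : nat) (S : {set ZNd N d})
    (f : ZNd N d -> R[i]) (x : ZNd N d) :
  (0 < N)%N -> supported_in (fourier f) S ->
  cabs (f x) <= \sum_(m in S) cabs (fourier f m).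
Proof.
move=> N0 fS; rewrite {1}(fourier_inversion f x N0) (bigID (mem S)) /=.
rewrite [X in _ + X]big1 ?addr0 => [|m /fS ->]; last by rewrite mulr0.
apply: le_trans (normc_sum _ _) _; apply: ler_sum => m _.
by rewrite Normc.normcM normc_chi mul1r.
Qed.

Lemma normc_fourier_le (R : realType) (N d : nat) (E : {set ZNd N d})
    (f : ZNd N d -> R[i]) (m : ZNd N d) :
  supported_in f E ->
  cabs (fourier f m) <= ((N ^ d)%N%:R)^-1 * \sum_(x in E) cabs (f x).
Proof.
move=> fE; rewrite Normc.normcM Normc.normcV normc_natr.
apply: ler_wpM2l; first by rewrite invr_ge0 ler0n.
rewrite (bigID (mem E)) /= [X in _ + X]big1 ?addr0 => [|x /fE ->]; last first.
  by rewrite mulr0.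
apply: le_trans (normc_sum _ _) _; apply: ler_sum => x _.
by rewrite Normc.normcM normc_chi mul1r.
Qed.

Lemma normc_argmax (R : realType) (T : finType) (f : T -> R[i]) :
  f <> (fun=> 0) ->
  exists x0, 0 < cabs (f x0) /\ forall x, cabs (f x) <= cabs (f x0).
Proof.
move=> f0; have [x1 fx1] : exists x, f x != 0.
  apply: contrapT => h; apply: f0; apply/funext => x; apply/eqP.
  by apply/negP => /negP fx; apply: h; exists x.
case: (@arg_maxP _ _ _ x1 xpredT (fun x => cabs (f x))) => // x0 _ hx0.
exists x0; split=> [|x]; last exact: hx0.
apply: lt_le_trans (hx0 x1 isT); rewrite lt_def normc_ge0 andbT.
by apply: contra fx1 => /eqP /Normc.eq0_normc ->.
Qed.

(** With [F] the maximum of [|f|] and [M = N^d], inversion and the trivial bound on [fourier f] give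
    [F <= |S| M^-1 |E| F]; cancel [F > 0]. *)
Lemma fourier_uncertainty (R : realType) (N d : nat) (E S : {set ZNd N d})
    (f : ZNd N d -> R[i]) :
  (0 < N)%N -> f <> (fun=> 0) ->
  supported_in f E -> supported_in (fourier f) S ->
  ((N ^ d)%N%:R : R) <= #|E|%:R * #|S|%:R.
Proof.
move=> N0 f0 fE fS; have [x0 [F0 Fmax]] := normc_argmax f0.
have M0 : 0 < (N ^ d)%N%:R :> R by rewrite ltr0n expn_gt0 N0.
rewrite -(ler_pM2r F0).
have h : \sum_(m in S) cabs (fourier f m) <=
    #|S|%:R * (((N ^ d)%N%:R)^-1 * (#|E|%:R * cabs (f x0))).
  rewrite [leRHS]mulr_natl -sumr_const; apply: ler_sum => m _.
  apply: le_trans (normc_fourier_le m fE) _.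
  rewrite ler_pM2l ?invr_gt0 // [leRHS]mulr_natl -sumr_const.
  exact: ler_sum.
move: (le_trans (normc_le_sum_fourier x0 N0 fS) h).
by rewrite mulrCA mulrC ler_pdivlMr // mulrC mulrA [#|S|%:R * _]mulrC.
Qed.

(** * Young functions, their inverses and Jensen's inequality *)

Lemma young_scale (R : realType) (Phi : R -> \bar R) (t x : R) :
  young Phi -> 0 <= t <= 1 -> 0 <= x -> (Phi (t * x)%R <= t%:E * Phi x)%E.
Proof.
move=> [_ conv Phi0 _ _] t01 x0; have := conv t x 0 t01 x0 (lexx 0).
by rewrite mulr0 addr0 Phi0 mule0 adde0.
Qed.

(** Monotonicity is not an axiom of [young]; it comes from convexity against [Phi 0 = 0], scaling
    [y] by [x / y]. *)
Lemma young_le (R : realType) (Phi : R -> \bar R) (x y : R) :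
  young Phi -> 0 <= x <= y -> (Phi x <= Phi y)%E.
Proof.
move=> yPhi /andP[x0 xy]; have [Pge0 _ _ _ _] := yPhi.
have y0 := le_trans x0 xy.
have [yE|yN0] := eqVneq y 0.
  by rewrite (_ : x = y) //; apply/le_anti; rewrite xy yE x0.
have ypos : 0 < y by rewrite lt_def yN0.
have t01 : 0 <= x / y <= 1 by rewrite divr_ge0 //= ler_pdivrMr // mul1r.
have := young_scale yPhi t01 y0; rewrite divfK // => /le_trans; apply.
by apply: gee_pMl; rewrite ?Pge0 ?lee_fin //; case/andP: t01.
Qed.

Lemma young_small (R : realType) (Phi : R -> \bar R) (e : R) :
  young Phi -> 0 < e -> exists2 x : R, 0 < x & (Phi x <= e%:E)%E.
Proof.
move=> [_ _ _ lim0 _] e0.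
have /lim0 : nbhs (0%E : \bar R) (fun u => u < e%:E)%E.
  by apply: open_ereal_lt'; rewrite lte_fin.
rewrite nbhs_filterE /fmap /= => near_e.
have [x [/= hx x0]] := 
  @filter_ex _ _ (at_right_proper_filter (0 : R)) _
    (filterI near_e (nbhs_right_gt 0)).
by exists x => //; exact: ltW.
Qed.

(** The real [sup] dominates its set only if that set is bounded above, which follows from [Phi]
    tending to infinity. *)
Lemma young_inv_ub (R : realType) (Phi : R -> \bar R) (x y : R) :
  young Phi -> 0 <= x -> (Phi x <= y%:E)%E -> x <= young_inv Phi y.
Proof.
move=> [_ _ _ _ /cvgeyPgt /(_ y) [A [_ hA]]] x0 hx.
apply: ub_le_sup => //; exists A => z [z0 hz]; rewrite leNgt.
by apply/negP => /hA /=; rewrite ltNge hz.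
Qed.

Lemma young_inv_gt0 (R : realType) (Phi : R -> \bar R) (y : R) :
  young Phi -> 0 < y -> 0 < young_inv Phi y.
Proof.
move=> yPhi /(young_small yPhi)[x x0 hx].
exact: lt_le_trans x0 (young_inv_ub yPhi (ltW x0) hx).
Qed.

(* For the empty sequence both means are the junk value [0 / 0 = 0]. *)
Lemma young_jensen (R : realType) (Phi : R -> \bar R) (I : eqType) (s : seq I)
    (F G : I -> R) :
  young Phi -> (forall i, i \in s -> 0 <= F i) ->
  (forall i, i \in s -> (Phi (F i) <= (G i)%:E)%E) ->
  (Phi ((\sum_(i <- s) F i) / (size s)%:R)%R <=
     ((\sum_(i <- s) G i) / (size s)%:R)%:E)%E.
Proof.
move=> [_ conv Phi0 _ _]; elim: s => [|i s IH] F0 FG.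
  by rewrite !big_nil !mul0r Phi0.
have {}IH := IH (fun j js => F0 j (mem_behead (s := i :: s) js))
                (fun j js => FG j (mem_behead (s := i :: s) js)).
have S0 : 0 <= (\sum_(j <- s) F j) / (size s)%:R.
  by rewrite divr_ge0 // big_seq sumr_ge0 // => j js; rewrite F0 // inE js orbT.
(* The new mean is a convex combination of the head and the old mean. If [s] is empty, the old mean
   has weight 0. *)
have meanE (H : I -> R) : (\sum_(j <- i :: s) H j) / (size s).+1%:R =
    (size s).+1%:R^-1 * H i +
    (1 - (size s).+1%:R^-1) * ((\sum_(j <- s) H j) / (size s)%:R).
  rewrite big_cons -natr1; case: s {IH F0 FG S0} => [|j s] /=.
    by rewrite big_nil mul0r mulr0 !addr0 mulrC.
  rewrite -!natr1; have := ler0n R (size s) => n0.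
  by clear -n0; field; lra.
have t01 : 0 <= ((size s).+1%:R^-1 : R) <= 1.
  by rewrite invr_ge0 ler0n invf_le1 ?ltr0n // ler1n.
have /andP[t0 t1] := t01.
rewrite [size _]/= !meanE; apply: le_trans (conv _ _ _ t01 _ S0) _.
  by rewrite F0 ?mem_head.
rewrite [leRHS]EFinD !EFinM; apply: leeD; apply: lee_wpmul2l => //.
- by rewrite FG ?mem_head.
- by rewrite lee_fin subr_ge0.
Qed.

(** * Bounds on the two Orlicz norms *)

(** For every admissible [k], Jensen gives [Psi (mean of |g| / k) <= 1], so the mean of [|g|] is at
    most [k * young_inv Psi 1]; then pass to the infimum over [k]. *)
Lemma sum_le_norm_LPhi_mu (R : realType) (N d : nat) (Psi : R -> \bar R)
    (S : {set ZNd N d}) (g : ZNd N d -> R[i]) :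
  young Psi -> (0 < #|S|)%N ->
  \sum_(m in S) cabs (g m) <=
    #|S|%:R * (young_inv Psi 1 * norm_LPhi_mu Psi S g).
Proof.
move=> yPsi S0; have [Pge0 _ _ _ _] := yPsi.
have sR : 0 < #|S|%:R :> R by rewrite ltr0n.
have q0 := young_inv_gt0 yPsi ltr01.
rewrite -ler_pdivrMl // -ler_pdivrMl //.
apply: lb_le_inf => [|k [k0 hk]]; last first.
  rewrite ler_pdivrMl // -ler_pdivrMr //.
  rewrite lee_pdivrMl // mule1 in hk.
  (* [young_jensen] takes real upper bounds, so the values of [Psi] must be finite; their sum is at
     most [|S|]. *)
  have Pfin m : m \in S -> Psi (cabs (g m) / k) \is a fin_num.
    have /sum_fin_numP h : \sum_(m in S) Psi (cabs (g m) / k) \is a fin_num.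
      rewrite ge0_fin_numE ?(le_lt_trans hk) ?ltry // sume_ge0 // => i _.
      by rewrite Pge0 // divr_ge0 ?normc_ge0 // ltW.
    by move=> mS; apply: h => //; rewrite mem_index_enum.
  have := @young_jensen _ Psi _ (enum S) (fun m => cabs (g m) / k)
    (fun m => fine (Psi (cabs (g m) / k))) yPsi.
  rewrite -cardE !big_enum /= -mulr_suml mulrC mulrA => jen.
  apply: young_inv_ub => //.
    rewrite mulr_ge0 ?mulr_ge0 ?invr_ge0 ?(ltW k0) ?(ltW sR) //.
    by rewrite sumr_ge0 // => i _; rewrite normc_ge0.
  apply: le_trans (jen _ _) _ => [m _|m|].
  - by rewrite divr_ge0 ?normc_ge0 // ltW.
  - by rewrite mem_enum => /Pfin mS; rewrite fineK.
  - rewrite lee_fin ler_pdivrMr // mul1r -lee_fin EFin_sum_fine //.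
(* An admissible [k] exists: take [F / x] with [Psi x <= 1] and [F] above every [|g m|]. The 1 in
   [F] keeps it positive even if [g] vanishes on [S]. *)
have [x x0 hx] := young_small yPsi ltr01.
pose F := 1 + \sum_(m in S) cabs (g m).
have F0 : 0 < F by rewrite ltr_pwDl // sumr_ge0 // => i _; rewrite normc_ge0.
exists (F / x); split; first by rewrite divr_gt0.
rewrite lee_pdivrMl // mule1.
apply: (@le_trans _ _ (\sum_(m in S) 1%E)); last first.
  by rewrite sumEFin sumr_const.
apply: lee_sum => m mS; apply: le_trans hx; apply: young_le => //.
rewrite invf_div mulrCA ler_piMr ?(ltW x0) // ?ler_pdivrMr //.
  by rewrite !mulr_ge0 ?normc_ge0 ?invr_ge0 // ltW.
rewrite mul1r /F (bigD1 m) //= addrCA ler_wpDr // addr_ge0 // sumr_ge0 // => i _.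
exact: normc_ge0.
Qed.

Lemma norm_LPhi_ge0 (R : realType) (N d : nat) (Phi : R -> \bar R)
    (A : {set ZNd N d}) (f : ZNd N d -> R[i]) :
  0 <= norm_LPhi Phi A f.
Proof.
rewrite /norm_LPhi; set K := (X in inf X).
(* With no admissible [k], the real infimum takes its default value 0. *)
have [->|/set0P K0] := eqVneq K set0; first by rewrite inf0.
by apply: lb_le_inf => // k [/ltW].
Qed.

(** The value [k = F / x] is admissible: each of the [|E|] terms in [E] is at most
    [Phi x <= 1 / |E|], and every other term is [Phi 0 = 0]. *)
Lemma norm_LPhi_le (R : realType) (N d : nat) (Phi : R -> \bar R)
    (E : {set ZNd N d}) (f : ZNd N d -> R[i]) (F x : R) :
  young Phi -> (0 < #|E|)%N -> supported_in f E ->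
  0 < F -> (forall y, cabs (f y) <= F) ->
  0 < x -> (Phi x <= (#|E|%:R^-1)%:E)%E ->
  norm_LPhi Phi [set: ZNd N d]%SET f <= F / x.
Proof.
move=> yPhi E0 fE F0 fF x0 hx; have [_ _ Phi0 _ _] := yPhi.
have eR : 0 < #|E|%:R :> R by rewrite ltr0n.
apply: ge_inf; first by exists 0 => k [/ltW].
split; first by rewrite divr_gt0.
rewrite (bigID (mem E)) /= [X in (_ + X)%E]big1 ?adde0; last first.
  by move=> y /andP[_ /fE ->]; rewrite Normc.normc0 mul0r.
apply: (@le_trans _ _ (\sum_(y in E) (#|E|%:R^-1)%:E)%E); last first.
  by rewrite sumEFin sumr_const lee_fin -[_ *+ _]mulr_natl mulfV ?gt_eqF.
rewrite (eq_bigl (mem E)) => [|y]; last by rewrite inE.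
apply: lee_sum => y _; apply: le_trans hx; apply: young_le => //.
rewrite invf_div mulrCA ler_piMr ?(ltW x0) // ?ler_pdivrMr ?mul1r //.
by rewrite !mulr_ge0 ?normc_ge0 ?invr_ge0 // ltW.
Qed.

Theorem theorem4p4 (R : realType) (Phi Psi : R -> \bar R) (C : R)
  (hPhi : nice_young Phi) (hPsi : nice_young Psi)
  (hxPhi : prec (fun x : R => x%:E) Phi) (hPhiPsi : prec Phi Psi)
  (N d : nat) (hN : (0 < N)%N) (hd : (0 < d)%N)
  (E S : {set ZNd N d}) (f : ZNd N d -> R[i])
  (hf0 : f <> (fun=> 0))
  (hfE : supported_in f E) (hfS : supported_in (fourier f) S)
  (hS : restriction_estimate Phi Psi S C) :
  #|E|%:R >= young_inv Phi (#|S|%:R / (N ^ d)%N%:R)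
             * ((N ^ d)%N%:R / #|S|%:R) ^+ 2
             * (1 / (young_inv Psi 1 * C)).
Proof.
have [yPhi _ _ _] := hPhi; have [yPsi _ _ _] := hPsi.
have [x0 [F0 Fmax]] := normc_argmax hf0.
have unc := fourier_uncertainty hN hf0 hfE hfS.
set M : R := (N ^ d)%N%:R in unc *; set q := young_inv Psi 1.
have M0 : 0 < M by rewrite ltr0n expn_gt0 hN.
(* Both sets are nonempty because [0 < M <= e s]. *)
have [s0 e0] : (0 < #|S|)%N /\ (0 < #|E|)%N.
  have := lt_le_trans M0 unc; rewrite -natrM ltr0n muln_gt0.
  by case/andP.
set s : R := #|S|%:R in unc *; set e : R := #|E|%:R in unc *.
have sR : 0 < s by rewrite ltr0n.
have eR : 0 < e by rewrite ltr0n.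
have q0 : 0 < q := young_inv_gt0 yPsi ltr01.
(* Chain inversion with Jensen, the restriction estimate and the bound [F / x] on the norm of [f],
   then cancel [F]. This is the bound on [Phi^-1(1/e)], stated pointwise. *)
have key x : 0 < x -> (Phi x <= (e^-1)%:E)%E -> x <= s * q * C / M.
  move=> xpos hx.
  have h1 := le_trans (normc_le_sum_fourier x0 hN hfS)
    (sum_le_norm_LPhi_mu (fourier f) yPsi s0).
  have h2 := norm_LPhi_le yPhi e0 hfE F0 Fmax xpos hx.
  have h3 := hS f.
  have n0 := norm_LPhi_ge0 Phi [set: ZNd N d]%SET f.
  have mu0 : 0 < norm_LPhi_mu Psi S (fourier f).
    have := lt_le_trans F0 h1; rewrite pmulr_rgt0 // pmulr_rgt0 //.
  (* The sign of [C] is not assumed: a nonpositive [C] would make the right side of the estimate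
     nonpositive, while its left side is positive. *)
  have CM0 : 0 < C * M^-1.
    have := lt_le_trans mu0 h3; rewrite ltNge; apply: contraNT; rewrite -leNgt.
    by move=> CM; exact: mulr_le0_ge0.
  have {h3} h3 := le_trans h3 (ler_wpM2l (ltW CM0) h2).
  have {h1} h1 : cabs (f x0) <= s * (q * (C * M^-1 * (cabs (f x0) / x))).
    by apply: le_trans h1 _; rewrite !ler_pM2l.
  have : cabs (f x0) * x <= cabs (f x0) * (s * q * C / M).
    rewrite -ler_pdivlMr //; apply: le_trans h1 _.
    by rewrite le_eqVlt; apply/orP; left; apply/eqP; ring.
  by rewrite ler_pM2l.
(* Any positive [x] with [Phi x <= 1 / e] forces the bound in [key], hence [C], to be positive. *)
have C0 : 0 < C.
  have einv : 0 < e^-1 by rewrite invr_gt0.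
  have [x xpos hx] := young_small yPhi einv.
  have := lt_le_trans xpos (key x xpos hx).
  by rewrite pmulr_lgt0 ?invr_gt0 // pmulr_rgt0 // mulr_gt0.
(* With [t = M / (e s) <= 1], convexity gives [Phi (t x) <= t Phi x <= 1 / e]
   as soon as [Phi x <= s / M]. *)
have supP : young_inv Phi (s / M) <= s * q * C / M * (e * s / M).
  apply: ge_sup => [|x [xge0 hx]].
    exists 0; split=> //; have [_ _ -> _ _] := yPhi.
    by rewrite lee_fin divr_ge0 // ltW.
  have [->|xN0] := eqVneq x 0.
    by rewrite ltW // !(mulr_gt0, invr_gt0).
  have xpos : 0 < x by rewrite lt_def xN0.
  rewrite -ler_pdivrMr ?(mulr_gt0, invr_gt0) // invf_div mulrC.
  have t0 : 0 < M / (e * s) by rewrite divr_gt0 ?mulr_gt0.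
  apply: key; first by rewrite mulr_gt0.
  apply: le_trans (young_scale yPhi _ xge0) _.
    by rewrite (ltW t0) ler_pdivrMr ?mulr_gt0 // mul1r.
  apply: le_trans (lee_wpmul2l _ hx) _; first by rewrite lee_fin ltW.
  rewrite -EFinM lee_fin le_eqVlt; apply/orP; left; apply/eqP; field.
  by rewrite !gt_eqF.
(* Moving the positive factors to the other side leaves [e s^2 q C / M^2], which is the bound in
   [supP]. *)
rewrite -mulrA -ler_pdivlMr ?(mulr_gt0, invr_gt0, exprn_gt0) //.
apply: le_trans supP _.
rewrite le_eqVlt; apply/orP; left; apply/eqP; field.
by rewrite !gt_eqF.
Qed.
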